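(* For every integer $n\ge3$, the transitive tournament $\overrightarrow{K_n}$ and its reflexive closure $r(\overrightarrow{K_n})$ are each invariant under some ordered partial Maltsev operation on their vertex set.
   Context: $\overrightarrow{K_n}$ is the digraph with vertex set $\{0,1,\dots,n-1\}$ and arc set $\{(i,j)\mid i<j\}$; its reflexive closure $r(\overrightarrow{K_n})$ adds a loop $(i,i)$ at every vertex, so its arc set is $\{(i,j)\mid i\le j\}$. For a total order $\le$ on a finite set $D$, the ordered partial Maltsev operation $M_{D,\le}$ is the ternary partial operation with $M_{D,\le}(x,y,y)=M_{D,\le}(y,y,x)=x$ whenever $x\le y$, undefined otherwise. A digraph is invariant under a partial operation if, whenever the operation applied coordinatewise to three arcs is defined in both coordinates, the resulting pair is an arc. *)

(* Defs.v *)
From mathcomp Require Import all_boot.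

Set Implicit Arguments.
Unset Strict Implicit.
Unset Printing Implicit Defensive.

Definition transitive_tournament (n : nat) : rel 'I_n := fun i j => i < j.

Definition reflexive_closure (V : finType) (E : rel V) : rel V :=
  fun x y => (x == y) || E x y.

Definition total_order (D : finType) (le : rel D) : Prop :=
  [/\ reflexive le, antisymmetric le, transitive le & total le].

(* [None] means undefined. *)
Definition partial_op3 (D : finType) := D -> D -> D -> option D.

(* The two defining clauses M(x,y,y) = x and M(y,y,x) = x overlap only at
   (x,x,x), where they agree, so the order of the tests is irrelevant. *)
Definition ordered_partial_maltsev (D : finType) (le : rel D) : partial_op3 D :=
  fun a b c =>
    if (b == c) && le a b then Some a
    else if (a == b) && le c b then Some c
    else None.

Lemma ordered_partial_maltsevP (D : finType) (le : rel D) (a b c r : D) :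
  ordered_partial_maltsev le a b c = Some r <->
  exists x y : D, [/\ le x y, r = x
    & (a, b, c) = (x, y, y) \/ (a, b, c) = (y, y, x)].
Proof.
rewrite /ordered_partial_maltsev; split.
  case: ifP => [/andP[/eqP <- lab] [<-]|_].
    by exists a, b; split=> //; left.
  case: ifP => // /andP[/eqP -> lcb] [<-].
  by exists c, b; split=> //; right.
case=> x [y [lxy -> [] [-> -> ->]]]; rewrite eqxx lxy //=.
by case: ifP => // /andP[/eqP ->].
Qed.

Definition invariant_under (V : finType) (E : rel V) (f : partial_op3 V) : Prop :=
  forall a1 a2 b1 b2 c1 c2 r1 r2 : V,
    E a1 a2 -> E b1 b2 -> E c1 c2 ->
    f a1 b1 c1 = Some r1 -> f a2 b2 c2 = Some r2 ->
    E r1 r2.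

(* Main.v *)
Require Import Defs.
From mathcomp Require Import all_boot.

(** The natural order serves both digraphs. If both coordinates use the same clause of M, the result
    is one of the given arcs; otherwise it is a given arc with its tail lowered, again an arc since
    [<] and [<=] both absorb [<=] on the left. *)

(* In the mixed case, M(x,y,y) in the first coordinate and M(y',y',x') in the
   second, the third arc is (y,x') and x <= y, so (x,x') is an arc. *)
Lemma invariant_under_ordered_partial_maltsev (V : finType) (E le : rel V) :
  (forall x y z, le x y -> E y z -> E x z) ->
  invariant_under E (ordered_partial_maltsev le).
Proof.
move=> leE a1 a2 b1 b2 c1 c2 r1 r2 Ea Eb Ec.
move=> /ordered_partial_maltsevP[x [y [le_xy -> def1]]].
move=> /ordered_partial_maltsevP[x' [y' [_ -> def2]]].
(* In the other mixed case the first arc is [(y, x')], so [leE] closes both. *)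
case: def1 def2 => -[? ? ?] [] [? ? ?]; subst=> //; exact: leE le_xy _.
Qed.

Lemma total_order_leq_ord (n : nat) : total_order (fun i j : 'I_n => i <= j).
Proof.
split=> [i|i j /anti_leq/val_inj//|j i k|i j]; first exact: leqnn.
  exact: leq_trans.
exact: leq_total.
Qed.

Lemma reflexive_closure_transitive_tournament (n : nat) (i j : 'I_n) :
  reflexive_closure (@transitive_tournament n) i j = (i <= j).
Proof. by rewrite leq_eqVlt. Qed.

Theorem theorem60 (n : nat) (hn : 3 <= n) :
  (exists le : rel 'I_n,
     total_order le /\
     invariant_under (@transitive_tournament n) (ordered_partial_maltsev le)) /\
  (exists le : rel 'I_n,
     total_order le /\
     invariant_under (reflexive_closure (@transitive_tournament n))
       (ordered_partial_maltsev le)).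
Proof.
split; exists (fun i j : 'I_n => i <= j); split;
  try exact: total_order_leq_ord;
  apply: invariant_under_ordered_partial_maltsev => i j k.
  exact: leq_ltn_trans.
rewrite !reflexive_closure_transitive_tournament; exact: leq_trans.
Qed.
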